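(* Let $(A,B) \in \mathbb{Z}^2$ be such that $4A^3 + 27B^2 \neq 0$, and let $\varepsilon > 0$ be fixed. Then for almost every squarefree integer $d \geq 1$ we have $\eta_d(A,B) > d^{1/4 - \varepsilon}$; that is, \[ \#\{ d \leq X : d \text{ squarefree},\ \eta_d(A,B) \leq d^{1/4-\varepsilon}\} = o(X) \quad (X \to \infty). \]
   Context: For a squarefree integer $d \geq 1$, let $E_d$ be the elliptic curve over $\mathbb{Q}$ given by $d y^2 = x^3 + Ax + B$ (the quadratic twist by $d$ of $y^2 = x^3 + Ax + B$). Let $\hat{h}_{E_d}$ be the canonical (Néron–Tate) height on $E_d(\mathbb{Q})$, normalized so that $\hat{h}_{E_d}(P) = \frac12 h_x(P) + O(1)$, where $h_x(x:y:z)$ is the logarithmic Weil height of $(x:z) \in \mathbb{P}^1(\mathbb{Q})$. Define $\eta_d(A,B)$ by $\log \eta_d(A,B) = \min\{\hat{h}_{E_d}(P) : P \in E_d(\mathbb{Q}) \setminus E_d(\mathbb{Q})_{\mathrm{tors}}\}$ if $E_d(\mathbb{Q})$ has positive rank, and $\eta_d(A,B) = \infty$ if $E_d(\mathbb{Q})$ has rank $0$. *)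

(* Defs.v *)
From HB Require Import structures.
From mathcomp Require Import all_boot all_order all_algebra finmap.
From mathcomp Require Import all_classical all_reals all_analysis.

Set Implicit Arguments.
Unset Strict Implicit.
Unset Printing Implicit Defensive.

Import Order.TTheory GRing.Theory Num.Theory.
Import numFieldNormedType.Exports.

Local Open Scope classical_set_scope.
Local Open Scope ring_scope.

Definition squarefree (d : nat) : Prop :=
  forall m : nat, (m ^ 2 %| d)%N -> m = 1%N.

(* [Inf] is the point (0 : 1 : 0), the neutral element of the group law. *)
Inductive point : Type := Inf | Aff of rat & rat.

(* The Mordell-Weil group E_d(Q) of d y^2 = x^3 + A x + B. *)
Definition twist_points (A B : int) (d : nat) : set point :=
  [set P | match P with
           | Inf => True
           | Aff x y => d%:R * y ^+ 2 = x ^+ 3 + A%:~R * x + B%:~R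
           end].

Definition opp_pt (P : point) : point :=
  match P with Inf => Inf | Aff x y => Aff x (- y) end.

(* Chord-and-tangent law on d y^2 = x^3 + A x + B: a line of slope l meets the
   curve in three points whose x-coordinates add up to d l^2. *)
Definition add_pt (A : int) (d : nat) (P Q : point) : point :=
  match P, Q with
  | Inf, _ => Q
  | _, Inf => P
  | Aff x1 y1, Aff x2 y2 =>
      if (x1 == x2) && (y1 == - y2) then Inf
      else
        let l := if x1 == x2
                 then (3 * x1 ^+ 2 + A%:~R) / (2 * d%:R * y1)
                 else (y2 - y1) / (x2 - x1) in
        let x3 := d%:R * l ^+ 2 - x1 - x2 in
        Aff x3 (l * (x1 - x3) - y1)
  end.

Definition muln_pt (A : int) (d n : nat) (P : point) : point :=
  iter n (add_pt A d P) Inf.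

Definition mulz_pt (A : int) (d : nat) (c : int) (P : point) : point :=
  match c with
  | Posz n => muln_pt A d n P
  | Negz n => opp_pt (muln_pt A d n.+1 P)
  end.

Definition torsion_pt (A : int) (d : nat) (P : point) : Prop :=
  exists2 n : nat, (0 < n)%N & muln_pt A d n P = Inf.

Definition nontorsion_points (A B : int) (d : nat) : set point :=
  [set P | twist_points A B d P /\ ~ torsion_pt A d P].

Definition independent_pts (A : int) (d r : nat) (P : 'I_r -> point) : Prop :=
  forall c : 'I_r -> int,
    \big[add_pt A d/Inf]_(i < r) mulz_pt A d (c i) (P i) = Inf ->
    forall i, c i = 0.

Definition rank_ge (A B : int) (d r : nat) : Prop :=
  exists P : 'I_r -> point,
    (forall i, twist_points A B d (P i)) /\ independent_pts A d P.

(* Logarithmic Weil height of (x : z) in P^1(Q); it vanishes at (1 : 0). *)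
Definition height_x (R : realType) (P : point) : R :=
  match P with
  | Inf => 0
  | Aff x _ => ln (Num.max `|numq x| (denq x))%:~R
  end.

(* Tate's limit of (1/2) h_x(2^n P) / 4^n, which is normalized so that it
   differs from (1/2) h_x(P) by a bounded amount. *)
Definition canonical_height (R : realType) (A : int) (d : nat) (P : point) : R :=
  lim ((fun n : nat =>
          2^-1 * height_x R (iter n (fun Q => add_pt A d Q Q) P) / 4 ^+ n)
       @ \oo).

(* The minimum over nontorsion points, when there are any, is attained by
   Northcott's theorem, and is thus the infimum. *)
Definition eta (R : realType) (A B : int) (d : nat) : \bar R :=
  if `[< rank_ge A B d 1 >]
  then (expR (inf [set canonical_height R A d P
                  | P in nontorsion_points A B d]))%:E
  else +oo%E.

Definition small_eta_count (R : realType) (A B : int) (e X : R) : nat :=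
  #|` fset_set [set d : nat | [/\ d%:R <= X, squarefree d
        & (eta R A B d <= (d%:R `^ (4^-1 - e))%:E)%E]] |%fset.

(* Main.v *)
Require Import Defs.
From mathcomp Require Import all_boot all_order all_algebra.
From mathcomp Require Import all_classical all_reals all_analysis.
From mathcomp Require Import finmap zify ring lra.

Import Order.TTheory GRing.Theory Num.Theory.
Import numFieldNormedType.Exports.
Local Open Scope classical_set_scope.
Local Open Scope ring_scope.

(** The x-coordinate of [2P] is a rational function of the x-coordinate of [P]
which does not involve [d]. Hence [|h_x(2P) - 4 h_x(P)|] is bounded in terms of
[A] and [B] only, and Tate's limit is at least [h_x(P)/2 - c] with [c]
independent of [d]. If [eta_d <= d^(1/4 - e)] with [d <= X], then [E_d] has a
nontorsion point [(x, y)] with [x] of height [O(X^(1/2 - 2 e))], and [d] is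
recovered from [x] as the squarefree part of [x^3 + A x + B]. There are only
[O(X^(1 - 4 e))] such [x]. *)

(** * The duplication forms: size and common factors *)

Lemma ler_norm_monomial (c p q M : int) (i j : nat) :
  `|p| <= M -> `|q| <= M -> `|c * p ^+ i * q ^+ j| <= `|c| * M ^+ (i + j).
Proof.
move=> pM qM; rewrite !normrM !normrX exprD mulrA.
have M0 : 0 <= M by apply: le_trans pM.
rewrite ler_pM ?mulr_ge0 ?exprn_ge0 //; first rewrite ler_wpM2l //.
  by rewrite lerXn2r ?nnegrE.
by rewrite lerXn2r ?nnegrE.
Qed.

Lemma ler_norm_add4 (a b c d a' b' c' d' : int) :
  `|a| <= a' -> `|b| <= b' -> `|c| <= c' -> `|d| <= d' ->
  `|a + b + c + d| <= a' + b' + c' + d'.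
Proof.
move=> ha hb hc hd; do 3! (apply: le_trans (ler_normD _ _) _; apply: lerD => //).
Qed.

(** Meant for the cofactors in the two resultant identities, which are binary cubic forms in [p] and
    [q]. *)
Lemma ler_norm_cubic (a b c d p q M : int) : `|p| <= M -> `|q| <= M ->
  `|a * p ^+ 3 + b * p ^+ 2 * q + c * p * q ^+ 2 + d * q ^+ 3|
    <= (`|a| + `|b| + `|c| + `|d|) * M ^+ 3.
Proof.
move=> pM qM.
have := ler_norm_monomial a p q M 3 0 pM qM.
have := ler_norm_monomial b p q M 2 1 pM qM.
have := ler_norm_monomial c p q M 1 2 pM qM.
have := ler_norm_monomial d p q M 0 3 pM qM.
rewrite !expr0 !expr1 !mulr1 => Hd Hc Hb Ha; rewrite !mulrDl.
exact: ler_norm_add4.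
Qed.

(* For [x = p / q], the doubled point has x-coordinate
   [dupl_num A B p q / dupl_den A B p q]. *)
Definition dupl_num (A B p q : int) : int :=
  p ^+ 4 - 2 * A * p ^+ 2 * q ^+ 2 - 8 * B * p * q ^+ 3 + A ^+ 2 * q ^+ 4.

Definition dupl_den (A B p q : int) : int :=
  4 * q * (p ^+ 3 + A * p * q ^+ 2 + B * q ^+ 3).

(* The cofactors in the next two identities are those of Silverman, "The
   Arithmetic of Elliptic Curves", Sublemma VIII.4.3. *)
Lemma dupl_resultant_den (A B p q : int) :
  (12 * p ^+ 2 * q + 16 * A * q ^+ 3) * dupl_num A B p q
  - (3 * p ^+ 3 - 5 * A * p * q ^+ 2 - 27 * B * q ^+ 3) * dupl_den A B p q
  = 4 * (4 * A ^+ 3 + 27 * B ^+ 2) * q ^+ 7.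
Proof. rewrite /dupl_num /dupl_den; ring. Qed.

Lemma dupl_resultant_num (A B p q : int) :
  (4 * (4 * A ^+ 3 + 27 * B ^+ 2) * p ^+ 3 - 4 * A ^+ 2 * B * p ^+ 2 * q
   + 4 * A * (3 * A ^+ 3 + 22 * B ^+ 2) * p * q ^+ 2
   + 12 * B * (A ^+ 3 + 8 * B ^+ 2) * q ^+ 3) * dupl_num A B p q
  + (A ^+ 2 * B * p ^+ 3 + A * (5 * A ^+ 3 + 32 * B ^+ 2) * p ^+ 2 * q
     + 2 * B * (13 * A ^+ 3 + 96 * B ^+ 2) * p * q ^+ 2
     - 3 * A ^+ 2 * (A ^+ 3 + 8 * B ^+ 2) * q ^+ 3) * dupl_den A B p q
  = 4 * (4 * A ^+ 3 + 27 * B ^+ 2) * p ^+ 7.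
Proof. rewrite /dupl_num /dupl_den; ring. Qed.

(** By the two identities [k] divides [D * p ^+ 7] and [D * q ^+ 7]; a Bezout relation between the
    coprime seventh powers leaves [D]. This limits the cancellation in the duplication fraction. *)
Lemma dvd_disc_dupl (A B p q k : int) : coprimez p q ->
  (k %| dupl_num A B p q)%Z -> (k %| dupl_den A B p q)%Z ->
  (k %| 4 * (4 * A ^+ 3 + 27 * B ^+ 2))%Z.
Proof.
move=> cpq kF kG; set D := 4 * _.
have kp : (k %| D * p ^+ 7)%Z.
  by rewrite -(dupl_resultant_num _ _ _ q); apply: rpredD; apply: dvdz_mull.
have kq : (k %| D * q ^+ 7)%Z.
  by rewrite -(dupl_resultant_den _ _ p); apply: rpredB; apply: dvdz_mull.
have : coprimez (p ^+ 7) (q ^+ 7) by rewrite coprimezXl // coprimezXr.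
case/coprimezP => -[u v] /= uv.
have -> : D = u * (D * p ^+ 7) + v * (D * q ^+ 7).
  by rewrite -[LHS]mulr1 -uv; ring.
by apply: rpredD; apply: dvdz_mull.
Qed.

Lemma dupl_upper_bound (A B p q M : int) : `|p| <= M -> `|q| <= M ->
  `|dupl_num A B p q| <= (1 + `|2 * A| + `|8 * B| + `|A ^+ 2|) * M ^+ 4 /\
  `|dupl_den A B p q| <= (4 + `|4 * A| + `|4 * B|) * M ^+ 4.
Proof.
move=> pM qM; split.
  have -> : dupl_num A B p q = 1 * p ^+ 4 * q ^+ 0 + (- (2 * A)) * p ^+ 2 * q ^+ 2
      + (- (8 * B)) * p ^+ 1 * q ^+ 3 + A ^+ 2 * p ^+ 0 * q ^+ 4.
    by rewrite /dupl_num; ring.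
  rewrite -(normrN (2 * A)) -(normrN (8 * B)) -[1]normr1 !mulrDl.
  by apply: ler_norm_add4; exact: ler_norm_monomial.
have -> : dupl_den A B p q = 4 * p ^+ 3 * q ^+ 1 + (4 * A) * p ^+ 1 * q ^+ 3
      + 4 * B * p ^+ 0 * q ^+ 4 + 0.
  by rewrite /dupl_den; ring.
rewrite [X in (X + _ + _) * _](_ : 4 = `|4 : int|) // -[_ * M ^+ 4]addr0.
rewrite 2!(mulrDl _ _ (M ^+ 4)).
by apply: ler_norm_add4; rewrite ?normr0 //; exact: ler_norm_monomial.
Qed.

(** Here [k] plays the factor cancelled in the duplication fraction and [H] the height of the
    reduced fraction. As [k] divides [D != 0], both forms are at most [|D| * H], and the resultant
    identities turn this into a bound on [p] and [q]. *)
Lemma dupl_lower_bound (A B : int) : 4 * A ^+ 3 + 27 * B ^+ 2 <> 0 ->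
  exists2 C : int, 0 < C & forall p q k H : int, coprimez p q ->
    0 < Num.max `|p| `|q| ->
    (k %| dupl_num A B p q)%Z -> (k %| dupl_den A B p q)%Z ->
    `|dupl_num A B p q| <= `|k| * H -> `|dupl_den A B p q| <= `|k| * H ->
    Num.max `|p| `|q| ^+ 4 <= C * H.
Proof.
move=> hD; set D := 4 * (4 * A ^+ 3 + 27 * B ^+ 2).
have D0 : D != 0 by rewrite mulf_neq0 //; apply/eqP.
(* Sums of the absolute coefficients of the cofactors: [f1], [g1] for the identity ending in
   [q ^+ 7], [f2], [g2] for the one ending in [p ^+ 7]. Zeros mark absent monomials. *)
pose f1 := `|0 : int| + `|12 : int| + `|0 : int| + `|16 * A|.
pose g1 := `|3 : int| + `|0 : int| + `|- (5 * A)| + `|- (27 * B)|.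
pose f2 := `|D| + `|- (4 * A ^+ 2 * B)| + `|4 * A * (3 * A ^+ 3 + 22 * B ^+ 2)|
   + `|12 * B * (A ^+ 3 + 8 * B ^+ 2)|.
pose g2 := `|A ^+ 2 * B| + `|A * (5 * A ^+ 3 + 32 * B ^+ 2)|
   + `|2 * B * (13 * A ^+ 3 + 96 * B ^+ 2)| + `|- (3 * A ^+ 2 * (A ^+ 3 + 8 * B ^+ 2))|.
have f10 : 0 <= f1 by rewrite !addr_ge0.
have g10 : 0 <= g1 by rewrite !addr_ge0.
have f20 : 0 <= f2 by rewrite !addr_ge0.
have g20 : 0 <= g2 by rewrite !addr_ge0.
exists (f1 + g1 + f2 + g2).
  have : 0 < g1 by rewrite /g1 -!addrA; apply: ltr_pwDl => //; rewrite !addr_ge0.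
  by lra.
move=> p q k H cpq; set M := Num.max _ _ => M0 kF kG FH GH.
have pM : `|p| <= M by rewrite le_max lexx.
have qM : `|q| <= M by rewrite le_max lexx orbT.
have kD : `|k| <= `|D|.
  have /dvdzP[m Dm] : (k %| D)%Z by apply: dvd_disc_dupl kF kG.
  have m0 : m != 0 by apply: contra D0 => /eqP m0; rewrite Dm m0 mul0r.
  by rewrite Dm normrM ler_peMl // -gtz0_ge1 normr_gt0.
have k0 : 0 < `|k|.
  rewrite normr_gt0; apply: contra D0 => /eqP k0.
  by have := dvd_disc_dupl A B p q k cpq kF kG; rewrite k0 dvd0z.
have H0 : 0 <= H by rewrite -(pmulr_rge0 _ k0); apply: le_trans FH.
(* Used with [t] equal to [p] and to [q]; the factor [|D|] occurs on both sides and cancels. *)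
have main (t a b u v : int) :
    a * dupl_num A B p q + b * dupl_den A B p q = D * t ^+ 7 ->
    `|a| <= u * M ^+ 3 -> `|b| <= v * M ^+ 3 ->
    `|t| ^+ 7 <= (u + v) * H * M ^+ 3.
  move=> e au bv.
  rewrite -(ler_pM2l (_ : 0 < `|D|)) ?normr_gt0 // -normrX -normrM -e.
  apply: le_trans (ler_normD _ _) _; rewrite (normrM a) (normrM b).
  have h1 : `|a| * `|dupl_num A B p q| <= u * M ^+ 3 * (`|D| * H).
    by apply: ler_pM => //; apply: le_trans FH _; rewrite ler_wpM2r.
  have h2 : `|b| * `|dupl_den A B p q| <= v * M ^+ 3 * (`|D| * H).
    by apply: ler_pM => //; apply: le_trans GH _; rewrite ler_wpM2r.
  apply: le_trans (lerD h1 h2) _; rewrite le_eqVlt; apply/orP; left.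
  by apply/eqP; ring.
(* Multiplying by [M ^+ 3] makes the left side [M ^+ 7], which is [|p| ^+ 7] or [|q| ^+ 7]. *)
rewrite -(ler_pM2r (_ : 0 < M ^+ 3)) ?exprn_gt0 // -exprD.
have hp : `|p| ^+ 7 <= (f2 + g2) * H * M ^+ 3.
  apply: (main _ _ _ _ _ (dupl_resultant_num A B p q)).
    by apply: le_trans (ler_norm_cubic _ _ _ _ _ _ _ pM qM); rewrite !mulNr.
  by apply: le_trans (ler_norm_cubic _ _ _ _ _ _ _ pM qM); rewrite !mulNr.
have hq : `|q| ^+ 7 <= (f1 + g1) * H * M ^+ 3.
  have e := dupl_resultant_den A B p q.
  rewrite -mulNr in e.
  apply: (main _ _ _ _ _ e).
    apply: le_trans (ler_norm_cubic 0 12 0 (16 * A) _ _ _ pM qM).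
    by rewrite !mul0r add0r addr0.
  rewrite normrN.
  apply: le_trans (ler_norm_cubic 3 0 (- (5 * A)) (- (27 * B)) _ _ _ pM qM).
  by rewrite !mul0r addr0 !mulNr.
have W (a b : int) : 0 <= a -> 0 <= b -> 
  a * H * M ^+ 3 <= (a + b) * H * M ^+ 3.
  by move=> a0 b0; rewrite !ler_wpM2r ?exprn_ge0 ?lerDl // ltW.
have [e|e] : M = `|q| \/ M = `|p|.
- by rewrite /M; case: (leP `|p| `|q|) => _; [left | right].
- rewrite [X in X ^+ (4 + 3)]e; apply: le_trans hq _.
  by rewrite -(addrA (f1 + g1)); apply: W; exact: addr_ge0.
- rewrite [X in X ^+ (4 + 3)]e; apply: le_trans hp _.
  by rewrite -(addrA (f1 + g1)) (addrC (f1 + g1)); apply: W; exact: addr_ge0.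
Qed.

(** * The Weil height under doubling *)

(** The multiplicative height, kept in [int] so that divisibility and size can be compared
    directly. *)
Definition weil_height (P : Defs.point) : int :=
  match P with
  | Inf => 1
  | Aff x _ => Num.max `|numq x| (denq x)
  end.

Lemma weil_height_ge1 (P : Defs.point) : 1 <= weil_height P.
Proof. by case: P => //= x y; rewrite le_max -(gtz0_ge1 (denq x)) denq_gt0 orbT. Qed.

Lemma height_xE (R : realType) (P : Defs.point) :
  height_x R P = ln (weil_height P)%:~R.
Proof. by case: P => //=; rewrite ln1. Qed.

Lemma dupl_on_curve (A B : int) (d : nat) (P : Defs.point) : (0 < d)%N ->
  twist_points A B d P -> twist_points A B d (add_pt A d P P).
Proof.
case: P => //= x y d0 E; rewrite eqxx /=.
case: eqP => // yN.
have y0 : y != 0 by apply/eqP => y0; apply: yN; rewrite y0 oppr0.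
have d0' : (d%:R : rat) != 0 by rewrite pnatr_eq0 -lt0n.
(* Eliminating [B] through the curve equation leaves an identity of rational functions in [x], [y],
   [d] and [A]. *)
have EB : B%:~R = d%:R * y ^+ 2 - x ^+ 3 - A%:~R * x by rewrite E; ring.
by rewrite /twist_points /= EB; field; rewrite d0' y0.
Qed.

(** For the tangent slope [l], [d * l ^+ 2] is [(3 * x ^+ 2 + A) ^+ 2 / (4 * d * y ^+ 2)], and
    [d * y ^+ 2] is the cubic in [x]; so [d] drops out. *)
Lemma dupl_x (A B : int) (d : nat) (x y : rat) : (0 < d)%N -> y != 0 ->
  twist_points A B d (Aff x y) ->
  exists x' y', add_pt A d (Aff x y) (Aff x y) = Aff x' y' /\
    x' * (dupl_den A B (numq x) (denq x))%:~R
      = (dupl_num A B (numq x) (denq x))%:~R.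
Proof.
move=> d0 y0 /= E; rewrite eqxx /=.
case: eqP => [yN|_].
  by move: y0; have -> : y = 0 by lra.
do 2!eexists; split; first by reflexivity.
have d0' : (d%:R : rat) != 0 by rewrite pnatr_eq0 -lt0n.
have q0 : ((denq x)%:~R : rat) != 0 by rewrite intr_eq0 denq_neq0.
have EB : B%:~R = d%:R * y ^+ 2 - x ^+ 3 - A%:~R * x by rewrite E; ring.
have Ep : (numq x)%:~R = x * (denq x)%:~R by rewrite numqE.
rewrite /dupl_num /dupl_den !(rmorphD, rmorphB, rmorphN, rmorphM, rmorphXn) /=.
rewrite Ep EB.
by field; rewrite d0' y0.
Qed.

(** [k] is the factor lost in reducing [F / G]: [denq z] divides [numq z * G] and is prime to
    [numq z], hence divides [G]. *)
Lemma int_fraction_scale (z : rat) (F G : int) : z * G%:~R = F%:~R ->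
  exists k : int, F = k * numq z /\ G = k * denq z.
Proof.
move=> E.
have e : numq z * G = denq z * F.
  apply: (@intr_inj rat); rewrite !rmorphM /= -E numqE; ring.
have : (denq z %| G)%Z.
  rewrite -(Gauss_dvdzr (m := denq z) (n := numq z)) ?e ?dvdz_mulr //.
  by rewrite coprimez_sym; exact: coprime_num_den.
case/dvdzP => k Gk; exists k; split => //.
apply: (mulfI (denq_neq0 z)); rewrite -e Gk; ring.
Qed.

(* This includes the case where [2P] is [Inf], of height 1, so that no iterate of
   a nontorsion point has to be shown affine, which would need associativity. *)
Lemma weil_height_dupl (A B : int) : 4 * A ^+ 3 + 27 * B ^+ 2 <> 0 ->
  exists2 C : int, 1 <= C & forall (d : nat) (P : Defs.point), (0 < d)%N ->
    twist_points A B d P ->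
    weil_height (add_pt A d P P) <= C * weil_height P ^+ 4 /\
    weil_height P ^+ 4 <= C * weil_height (add_pt A d P P).
Proof.
move=> hD; have [C C0 lowC] := dupl_lower_bound _ _ hD.
pose a := 1 + `|2 * A| + `|8 * B| + `|A ^+ 2|.
pose b := 4 + `|4 * A| + `|4 * B|.
have a0 : 0 <= a by rewrite !addr_ge0.
have b0 : 0 <= b by rewrite !addr_ge0.
have C1 : 1 <= C by rewrite -gtz0_ge1.
have K1 : 1 <= C + a + b by lra.
exists (C + a + b) => // d P d0 onP.
suff [h1 h2] : weil_height (add_pt A d P P) <= (C + a + b) * weil_height P ^+ 4
    /\ weil_height P ^+ 4 <= C * weil_height (add_pt A d P P).
  split=> //; apply: le_trans h2 _; rewrite ler_wpM2r //; last by lra.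
  by have := weil_height_ge1 (add_pt A d P P); lra.
have H1 := weil_height_ge1 P.
have H4 : 1 <= weil_height P ^+ 4 by rewrite exprn_ege1.
case: P onP H1 H4 => [|x y] onP H1 H4.
  by rewrite /= !expr1n !mulr1.
set p := numq x; set q := denq x; set M := weil_height (Aff x y) in H1 H4 *.
have Mpq : M = Num.max `|p| `|q| by rewrite /M /= normr_denq.
have M0 : 0 < Num.max `|p| `|q| by rewrite -Mpq; exact: lt_le_trans ltr01 H1.
have pM : `|p| <= M by rewrite Mpq le_max lexx.
have qM : `|q| <= M by rewrite Mpq le_max lexx orbT.
have cpq : coprimez p q by exact: coprime_num_den.
have [Fa Gb] := dupl_upper_bound A B p q M pM qM.
have M4 : 0 <= M ^+ 4 by rewrite exprn_ge0 // Mpq ltW.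
have [y0|y0] := eqVneq y 0.
  have -> : add_pt A d (Aff x y) (Aff x y) = Inf by rewrite /= y0 oppr0 !eqxx.
  have G0 : dupl_den A B p q = 0.
    move: onP; rewrite /= y0 expr0n mulr0 => E.
    apply: (@intr_inj rat).
    have Ep : (p%:~R : rat) = x * q%:~R by rewrite numqE.
    rewrite /dupl_den !(rmorphD, rmorphM, rmorphXn) /= Ep.
    have EB : B%:~R = - x ^+ 3 - A%:~R * x by rewrite -[LHS]subr0 [X in _ - X]E; ring.
    by rewrite EB; ring.
  split => /=; last first.
    rewrite Mpq; apply: (lowC p q (dupl_num A B p q)) => //.
    - by rewrite G0 dvdz0.
    - by rewrite mulr1.
    - by rewrite G0 normr0 mulr1.
  by rewrite -[X in X <= _]mulr1; apply: ler_pM.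
have [x' [y' [-> E]]] := dupl_x _ _ _ _ _ d0 y0 onP.
have [k [Fk Gk]] := int_fraction_scale _ _ _ E.
rewrite -/p -/q in Fk Gk.
set H := weil_height _.
have nH : `|numq x'| <= H by rewrite /H /= le_max lexx.
have dH : `|denq x'| <= H by rewrite /H /= normr_denq le_max lexx orbT.
split; last first.
  rewrite Mpq; apply: (lowC p q k) => //.
  - by rewrite Fk dvdz_mulr.
  - by rewrite Gk dvdz_mulr.
  - by rewrite Fk normrM ler_wpM2l.
  - by rewrite Gk normrM ler_wpM2l.
(* If [k] were 0, both forms would vanish, and the lower bound with [H = 0] would give
   [M ^+ 4 <= 0]. *)
have k1 : 1 <= `|k|.
  rewrite -gtz0_ge1 normr_gt0; apply/eqP => k0.
  have F0 : dupl_num A B p q = 0 by rewrite Fk k0 mul0r.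
  have G0 : dupl_den A B p q = 0 by rewrite Gk k0 mul0r.
  have := lowC p q 1 0 cpq M0; rewrite F0 G0 !dvdz0 normr0 !mulr0 lexx.
  by move=> /(_ isT isT isT isT); rewrite leNgt exprn_gt0.
have hn : `|numq x'| <= a * M ^+ 4.
  by apply: le_trans Fa; rewrite Fk normrM ler_peMl.
have hd : denq x' <= b * M ^+ 4.
  by apply: le_trans Gb; rewrite Gk normrM -{1}normr_denq ler_peMl.
have CM : 0 <= C * M ^+ 4 by rewrite mulr_ge0 // ltW.
have aM : 0 <= a * M ^+ 4 by rewrite mulr_ge0.
have bM : 0 <= b * M ^+ 4 by rewrite mulr_ge0.
by rewrite /H /= ge_max 2!(mulrDl _ _ (M ^+ 4)); apply/andP; split; lra.
Qed.

(** * Tate's limit and the canonical height *)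

(* The sequences [u n / 4 ^+ n -+ (c / 3) / 4 ^+ n] are monotone. *)
Lemma tate_limit_ge (R : realType) (u : nat -> R) (c : R) :
  (forall n, `|u n.+1 - 4 * u n| <= c) ->
  u 0%N - c / 3 <= lim ((fun n : nat => u n / 4 ^+ n) @ \oo).
Proof.
move=> hu.
(* [c / 3] is the sum of [c / 4 ^+ n] over [n >= 1]. [b] increases, [t] decreases and dominates [b],
   so the limit exists and is at least [b 0]. *)
pose b n := u n / 4 ^+ n - c / 3 / 4 ^+ n.
pose t n := u n / 4 ^+ n + c / 3 / 4 ^+ n.
have p4 n : 0 < (4 ^+ n : R)^-1 by rewrite invr_gt0 exprn_gt0.
have c0 : 0 <= c by apply: le_trans (hu 0%N).
have bE n : b n.+1 - b n = (u n.+1 - 4 * u n + c) / 4 ^+ n.+1.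
  by rewrite /b exprS; field; rewrite expf_neq0.
have tE n : t n - t n.+1 = (c - (u n.+1 - 4 * u n)) / 4 ^+ n.+1.
  by rewrite /t exprS; field; rewrite expf_neq0.
have b_nd : {homo b : n m / (n <= m)%N >-> n <= m}.
  apply/nondecreasing_seqP => n; rewrite -subr_ge0 bE.
  have := hu n; rewrite ler_norml => /andP[h1 h2].
  by apply: mulr_ge0; [lra | exact: ltW].
have t_ni n : t n <= t 0%N.
  elim: n => // n; apply: le_trans; rewrite -subr_ge0 tE.
  have := hu n; rewrite ler_norml => /andP[h1 h2].
  by apply: mulr_ge0; [lra | exact: ltW].
have b_cvg : cvgn b.
  apply: nondecreasing_is_cvgn => //; exists (t 0%N) => _ [n _ <-].
  apply: le_trans (t_ni n); rewrite /b /t lerD2l.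
  have : 0 <= c / 3 / 4 ^+ n by apply: mulr_ge0; [lra | exact: ltW].
  by lra.
have z_cvg : (fun n => c / 3 / 4 ^+ n) @ \oo --> (0 : R).
  have -> : (fun n => c / 3 / 4 ^+ n) = geometric (c / 3) (4^-1 : R).
    by apply/funext => n; rewrite /geometric /= exprVn.
  apply: cvg_geometric; rewrite ger0_norm //; lra.
have -> : (fun n => u n / 4 ^+ n) = (fun n => b n + c / 3 / 4 ^+ n).
  by apply/funext => n; rewrite /b subrK.
have := nondecreasing_cvgn_le b_nd b_cvg 0%N.
rewrite /b !expr0 !divr1 => /le_trans; apply.
have -> : lim ((fun n => b n + c / 3 / 4 ^+ n) @ \oo) = limn b + 0.
  by apply: cvg_lim => //; apply: cvgD.
by rewrite addr0.
Qed.

(** The constant is chosen before [d]: it comes from the doubling inequalities, which are uniform in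
    the twist. *)
Lemma canonical_height_ge (R : realType) (A B : int) :
  4 * A ^+ 3 + 27 * B ^+ 2 <> 0 ->
  exists c : R, forall (d : nat) (P : Defs.point), (0 < d)%N ->
    twist_points A B d P ->
    2^-1 * height_x R P - c <= canonical_height R A d P.
Proof.
move=> /weil_height_dupl[C C1 hC].
have posH Q : 0 < (weil_height Q)%:~R :> R.
  by rewrite ltr0z; exact: lt_le_trans ltr01 (weil_height_ge1 Q).
have posC : 0 < C%:~R :> R by rewrite ltr0z; exact: lt_le_trans C1.
(* Doubling changes half the logarithmic height from four times itself by at most [ln C / 2]; Tate's
   limit costs a third of that. *)
exists (ln C%:~R / 2 / 3) => d P d0 onP.
pose dbl := fun Q => add_pt A d Q Q.
have onI n : twist_points A B d (iter n dbl P).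
  by elim: n => //= n IH; exact: dupl_on_curve.
apply: (@tate_limit_ge R (fun n => 2^-1 * height_x R (iter n dbl P))) => n.
rewrite iterS; have := onI n; move: (iter n dbl P) => Q onQ.
have [h1 h2] := hC d Q d0 onQ; rewrite -/(dbl Q) in h1 h2.
rewrite !height_xE.
set a := ln (weil_height (dbl Q))%:~R; set b := ln (weil_height Q)%:~R.
have k1 : a <= ln C%:~R + 4 * b.
  rewrite /a /b [4 * _]mulr_natl -lnXn // -lnM ?posrE ?exprn_gt0 //.
  rewrite ler_ln ?posrE ?mulr_gt0 ?exprn_gt0 //.
  by rewrite -rmorphXn -rmorphM ler_int.
have k2 : 4 * b <= ln C%:~R + a.
  rewrite /a /b [4 * _]mulr_natl -lnXn // -lnM ?posrE ?exprn_gt0 //.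
  rewrite ler_ln ?posrE ?mulr_gt0 ?exprn_gt0 //.
  by rewrite -rmorphXn -rmorphM ler_int.
by rewrite ler_norml; apply/andP; split; lra.
Qed.

(** * Squarefree classes and nontorsion points *)

Lemma squarefree_gt0 (d : nat) : squarefree d -> (0 < d)%N.
Proof. by case: d => // /(_ 2%N (dvdn0 _)). Qed.

(** With [y / y'] in lowest terms, the square of its numerator divides [d'] and that of its
    denominator divides [d], so both are 1 up to sign. *)
Lemma squarefree_class_inj (d d' : nat) (y y' : rat) :
  squarefree d -> squarefree d' -> y' != 0 ->
  d%:R * y ^+ 2 = d'%:R * y' ^+ 2 -> d = d'.
Proof.
move=> sd sd' y'0 E; pose r := y / y'.
have Er : d%:R * r ^+ 2 = d'%:R.
  by rewrite /r expr_div_n mulrA E mulfK // expf_neq0.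
have En : (d * `|numq r| ^ 2 = d' * `|denq r| ^ 2)%N.
  have Ez : d%:Z * numq r ^+ 2 = d'%:Z * denq r ^+ 2.
    apply: (@intr_inj rat); rewrite !expr2 !rmorphM /= numqE.
    have -> : (d'%:Z%:~R : rat) = d%:R * r ^+ 2 by rewrite Er.
    by ring.
  by have := congr1 absz Ez; rewrite !abszM.
have cop : coprime (`|numq r| ^ 2) (`|denq r| ^ 2).
  by rewrite coprimeXl // coprimeXr // coprime_num_den.
have n1 : `|numq r|%N = 1%N.
  by apply: sd'; rewrite -(Gauss_dvdl _ cop) -En dvdn_mull.
have d1 : `|denq r|%N = 1%N.
  by apply: sd; rewrite coprime_sym in cop; rewrite -(Gauss_dvdl _ cop) En dvdn_mull.
by move: En; rewrite n1 d1 !muln1.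
Qed.

(** [Inf] is killed by 1, and a point with [y = 0] by 2. *)
Lemma nontorsion_affine (A B : int) (d : nat) (P : Defs.point) :
  nontorsion_points A B d P ->
  exists x y, [/\ P = Aff x y, y != 0
    & d%:R * y ^+ 2 = x ^+ 3 + A%:~R * x + B%:~R].
Proof.
case: P => [[_ []]|x y [onP tP]]; first by exists 1%N.
exists x, y; split=> //; apply/eqP => y0; apply: tP; exists 2%N => //=.
by rewrite y0 oppr0 !eqxx.
Qed.

(** Shows that the set under [inf] in [eta] is inhabited when the rank is positive. *)
Lemma rank_ge1_nontorsion (A B : int) (d : nat) :
  rank_ge A B d 1 -> nontorsion_points A B d !=set0.
Proof.
case=> P [onP indP]; exists (P ord0); split=> // -[n n0 nP].
have := indP (fun=> n%:Z); rewrite big_ord_recl big_ord0 /= nP.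
by move=> /(_ erefl ord0) [n00]; rewrite n00 in n0.
Qed.

(** * Counting the twists through x-coordinates *)

Lemma size_rat_height_le (T : eqType) (D : seq T) (x : T -> rat) (K : nat) :
  uniq D ->
  {in D &, injective x} ->
  (forall d, d \in D -> Num.max `|numq (x d)| (denq (x d)) <= K%:Z) ->
  (size D <= (K + K).+1 * K.+1)%N.
Proof.
move=> uD injx hx.
(* Adding [K] moves the numerator into [0..2K], so neither [inord] falls back to its default. *)
pose g d : 'I_(K + K).+1 * 'I_K.+1 :=
  (inord `|(numq (x d) + K%:Z)%R|%N, inord `|denq (x d)|%N).
have injg : {in D &, injective g}.
  move=> d d' dD dD' [].
  have q1 := denq_gt0 (x d); have q2 := denq_gt0 (x d').
  have := hx d dD; rewrite ge_max ler_norml => /andP[/andP[a1 a2] a3].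
  have := hx d' dD'; rewrite ge_max ler_norml => /andP[/andP[b1 b2] b3].
  move=> /(congr1 val); rewrite /= !inordK; [|lia..].
  move=> e1 /(congr1 val); rewrite /= !inordK; [|lia..] => e2.
  apply: injx => //; rewrite -[x d]divq_num_den -[x d']divq_num_den.
  have -> : numq (x d) = numq (x d') by lia.
  by have -> : denq (x d) = denq (x d') by lia.
rewrite -(size_map g) -[X in (_ <= X * _)%N]card_ord.
rewrite -[X in (_ <= _ * X)%N]card_ord -card_prod.
have /card_uniqP <- : uniq (map g D) by rewrite map_inj_in_uniq.
exact: max_card.
Qed.

Lemma small_eta_point (R : realType) (A B : int) :
  4 * A ^+ 3 + 27 * B ^+ 2 <> 0 ->
  exists c : R, forall (s : R) (d : nat), (0 < d)%N ->
    (eta R A B d <= (d%:R `^ s)%:E)%E ->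
    exists x y : rat, [/\ y != 0,
      d%:R * y ^+ 2 = x ^+ 3 + A%:~R * x + B%:~R
      & height_x R (Aff x y) <= 2 * (s * ln d%:R) + c].
Proof.
(* [2 * c] comes from the height comparison, and [2] from taking a point whose canonical height is
   within 1 of the infimum. *)
move=> /(canonical_height_ge R)[c hc]; exists (2 * c + 2) => s d d0.
rewrite /eta; case: asboolP => [/rank_ge1_nontorsion [P0 ntP0]|]; last first.
  by rewrite leye_eq.
set S := [set _ | _ in _].
have d0' : 0 < d%:R :> R by rewrite ltr0n.
rewrite lee_fin -ler_ln ?posrE ?expR_gt0 ?powR_gt0 // expRK ln_powR => hS.
have infS : has_inf S.
  split; first by exists (canonical_height R A d P0), P0.
  exists (- c) => _ [P [onP _] <-]; apply: le_trans (hc d P d0 onP).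
  rewrite lerDr mulr_ge0 // height_xE ln_ge0 // ler1z.
  exact: weil_height_ge1.
have [_ [P ntP <-] hP] := inf_adherent (ltr01 : (0 : R) < 1) infS.
have [x [y [EP y0 onP]]] := nontorsion_affine _ _ _ _ ntP.
exists x, y; split => //; rewrite -EP.
have := hc d P d0 (proj1 ntP); lra.
Qed.

(** Two exponents appear because passing from [d] to [X] in [d ^ (1/4 - e)] requires [e <= 1/4],
    whereas [e'] may be any larger number. *)
Lemma small_eta_count_le (R : realType) (A B : int) :
  4 * A ^+ 3 + 27 * B ^+ 2 <> 0 ->
  exists c : R, forall e' e X : R, e <= e' -> e <= 4^-1 -> 1 <= X ->
    (small_eta_count A B e' X)%:R
      <= 6 * expR (c + (1 - 4 * e) * ln X).
Proof.
move=> /(small_eta_point R)[c0 hc0].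
(* A nonnegative constant ensures [1 <= Y] below. *)
pose c := Num.max 0 c0.
have c_ge0 : 0 <= c by rewrite le_max lexx.
have c0c : c0 <= c by rewrite le_max lexx orbT.
exists (2 * c) => e' e X ee' e4 X1.
have lnX : 0 <= ln X by rewrite ln_ge0.
set Y := expR (c + (2^-1 - 2 * e) * ln X).
have Y1 : 1 <= Y.
  by rewrite -expR0 ler_expR addr_ge0 // mulr_ge0 //; lra.
pose K := Num.truncn Y.
have KY : K%:R <= Y by rewrite truncn_le; lra.
rewrite /small_eta_count; set S := [set d | _].
have finS : finite_set S.
  apply: (sub_finite_set (B := `I_(Num.truncn X).+1)); last exact: finite_II.
  move=> d [dX _ _] /=; rewrite ltnS truncn_ge_nat //; lra.
(* The value 0 outside [S] lets [choice] produce a total function. *)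
have wit d : exists x : rat, S d -> exists y : rat, [/\ y != 0,
    d%:R * y ^+ 2 = x ^+ 3 + A%:~R * x + B%:~R
    & Num.max `|numq x| (denq x) <= K%:Z].
  have [Sd|nS] := pselect (S d); last by exists 0.
  have [dX sd hd] := Sd; have d0 := squarefree_gt0 _ sd.
  have [x [y [y0 onP hx]]] := hc0 _ d d0 hd.
  exists x => _; exists y; split => //.
  have d0' : 0 < d%:R :> R by rewrite ltr0n.
  have lnd : ln d%:R <= ln X by rewrite ler_ln ?posrE //; lra.
  have H1 := weil_height_ge1 (Aff x y).
  have HY : (weil_height (Aff x y))%:~R <= Y.
    have H0 : 0 < (weil_height (Aff x y))%:~R :> R.
      by rewrite ltr0z; exact: lt_le_trans H1.
    rewrite -[leLHS]lnK ?posrE // ler_expR -height_xE.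
    apply: le_trans hx _.
    have : (4^-1 - e) * ln d%:R <= (4^-1 - e) * ln X by rewrite ler_wpM2l //; lra.
    have : (4^-1 - e') * ln d%:R <= (4^-1 - e) * ln d%:R.
      by rewrite ler_wpM2r ?ln_ge0 ?ler1n //; lra.
    lra.
  rewrite -[leLHS]/(weil_height (Aff x y)).
  have [n En] : exists n : nat, weil_height (Aff x y) = n%:Z.
    by case: (weil_height _) H1 => // n; exists n.
  rewrite En lez_nat truncn_ge_nat; last by lra.
  by move: HY; rewrite En.
have [x hx] := choice wit.
have hS d : d \in fset_set S -> S d by rewrite in_fset_set // => /set_mem.
have : (#|` fset_set S|%fset <= (K + K).+1 * K.+1)%N.
  apply: (size_rat_height_le _ _ x); first exact: fset_uniq.
  - move=> d d' /hS Sd /hS Sd' E.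
    have [y [y0 onP _]] := hx d Sd; have [y' [y0' onP' _]] := hx d' Sd'.
    have [_ sd _] := Sd; have [_ sd' _] := Sd'.
    by apply: (squarefree_class_inj _ _ y y') => //; rewrite onP onP' E.
  - by move=> d /hS Sd; have [y []] := hx d Sd.
rewrite -(ler_nat R) => /le_trans; apply.
rewrite natrM -[(K + K).+1]addn1 -[K.+1]addn1 !natrD.
have K0 : 0 <= K%:R :> R by rewrite ler0n.
(* The factor 6 arises from [2 * K + 1 <= 3 * Y] and [K + 1 <= 2 * Y], using [K <= Y] and
   [1 <= Y]. *)
have -> : expR (2 * c + (1 - 4 * e) * ln X) = Y ^+ 2.
  by rewrite expr2 -expRD; congr expR; field.
nra.
Qed.

(** * Passage to the limit *)

Lemma expRN_ln_cvg0 (R : realType) (a : R) : 0 < a ->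
  expR (- (a * ln X)) @[X --> +oo] --> (0 : R).
Proof.
move=> a0.
apply: (cvg_comp (fun X : R => a * ln X) (fun t => expR (- t)));
  last exact: cvgr_expR.
apply/cvgryPge => M; near=> X.
have X0 : 0 < X by near: X; exact: nbhs_pinfty_gt.
have MX : expR (M / a) <= X by near: X; exact: nbhs_pinfty_ge.
by rewrite mulrC -ler_pdivrMr // -[leLHS]expRK ler_ln ?posrE ?expR_gt0.
Unshelve. all: by end_near.
Qed.

Theorem theorem1 (R : realType) (A B : int)
  (hAB : 4 * A ^+ 3 + 27 * B ^+ 2 <> 0) (e : R) (he : 0 < e) :
  (small_eta_count A B e X)%:R / X @[X --> +oo] --> (0 : R).
Proof.
have [c hc] := small_eta_count_le R A B hAB.
(* Any positive bound up to [1/4] would do in place of [1/8], since the counting bound asks for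
   [e1 <= 1/4]. *)
pose e1 := Num.min e 8^-1.
have e1e : e1 <= e by rewrite ge_min lexx.
have e18 : e1 <= 8^-1 by rewrite ge_min lexx orbT.
have e10 : 0 < e1 by rewrite lt_min he /=; lra.
(* This is the counting bound divided by [X], a constant times [X] to the power [- 4 * e1]. *)
have lim0 : 6 * expR c * expR (- (4 * e1 * ln X)) @[X --> +oo] --> (0 : R).
  rewrite -[X in _ --> X](mulr0 (6 * expR c)); apply: cvgMr.
  by apply: expRN_ln_cvg0; lra.
apply: (squeeze_cvgr (f := fun=> 0) _ (cvg_cst _) lim0).
near=> X.
have X1 : 1 <= X by near: X; exact: nbhs_pinfty_ge.
have X0 : 0 < X by lra.
apply/andP; split; first by rewrite divr_ge0 // ltW.
rewrite ler_pdivrMr //.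
have := hc e e1 X e1e; move=> /(_ _ X1)/le_trans; apply; first by lra.
rewrite -[X in _ <= _ * X](lnK (_ : X \is Num.pos)) ?posrE // -!mulrA -!expRD.
by rewrite le_eqVlt; apply/orP; left; apply/eqP; congr (_ * expR _); ring.
Unshelve. all: by end_near.
Qed.
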